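(* Let $F:E_A\to\mathbb{R}$ be such that $F(X)$ is square-integrable and, for all $a\in A$, $$\sup_{x\in E_A,\ x'_a\in E_a}\big|F(x^{\{a\}},x'_a)-F(x)\big|\le d_a .$$ Then for every $x>0$, $$\mathbb{P}\big(F(X)-\mathbb{E}[F(X)\mid Z]\ge x\,\big|\,Z\big)\le\exp\left(-\frac{x^2}{2\sum_{a\in A}d_a^2}\right)\quad\text{almost surely}.$$
   Context: Setting. $A$ is an at most countable set, $E_0$ and $(E_a)_{a\in A}$ are Polish spaces and $E_A=\prod_{a\in A}E_a$. On a probability space, $Z$ is an $E_0$-valued random variable and $X=(X_a)_{a\in A}$ is a family of random variables, $X_a$ being $E_a$-valued, which is conditionally independent given $Z$: for each $a$, the conditional law of $X_a$ given $\sigma((X_b)_{b\ne a},Z)$ equals its conditional law given $\sigma(Z)$. For $x\in E_A$ and $x'_a\in E_a$, $(x^{\{a\}},x'_a)$ denotes $x$ with its $a$-th coordinate replaced by $x'_a$. *)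

(* Defs.v *)
From HB Require Import structures.
From mathcomp Require Export all_boot all_order all_algebra.
From mathcomp Require Export all_classical all_reals all_analysis.

Set Implicit Arguments.
Unset Strict Implicit.
Unset Printing Implicit Defensive.

Export Order.TTheory GRing.Theory Num.Theory.
Export numFieldNormedType.Exports.

Local Open Scope classical_set_scope.
Local Open Scope ring_scope.

Definition separable (T : topologicalType) : Prop :=
  exists2 D : set T, countable D & dense D.

Definition is_metric (R : realType) (T : Type) (dist : T -> T -> R) : Prop :=
  [/\ forall x y, 0 <= dist x y,
      forall x y, dist x y = 0 <-> x = y,
      forall x y, dist x y = dist y x &
      forall x y z, dist x z <= dist x y + dist y z].

Definition metrizes (R : realType) (T : topologicalType) (dist : T -> T -> R) :
    Prop :=
  forall x : T,
    nbhs x = filter_from [set e : R | 0 < e] (fun e => [set y | dist x y < e]).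

Definition complete_metric (R : realType) (T : topologicalType)
    (dist : T -> T -> R) : Prop :=
  forall u : nat -> T,
    (forall e : R, 0 < e ->
      exists N, forall m n, (N <= m)%N -> (N <= n)%N -> dist (u m) (u n) < e) ->
    exists l : T, u @ \oo --> l.

Definition polish (R : realType) (T : topologicalType) : Prop :=
  separable T /\
  exists dist : T -> T -> R,
    [/\ is_metric dist, metrizes dist & complete_metric dist].

Notation borelType T := (g_sigma_algebraType (@open T)).

(* The cylinder sets [set x | B (x a)], B Borel, generate the product
   sigma-algebra; for countably many Polish factors this is also the Borel
   sigma-algebra of the product topology. *)
Definition cylinders (A : Type) (E : A -> ptopologicalType) :
    set (set (forall a, E a)) :=
  \bigcup_a preimage_set_system setT (fun x : forall b, E b => x a)
              (measurable : set (set (borelType (E a)))).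

Arguments cylinders {A} E.

Notation prodType E := (g_sigma_algebraType (cylinders E)).

Definition joint (Omega A : Type) (E : A -> Type)
    (X : forall a, Omega -> E a) (w : Omega) : forall a, E a :=
  fun a => X a w.

Section conditioning.
Context {d : measure_display} {Omega : measurableType d} {R : realType}
  (P : probability Omega R).

(* The conditioning sigma-algebra is <<s G >>, the one generated by G. *)
Definition is_cond_exp (G : set (set Omega)) (f Y : Omega -> R) : Prop :=
  [/\ measurable_fun [set: g_sigma_algebraType G] Y,
      P.-integrable setT (EFin \o Y) &
      forall B : set Omega, <<s G >> B ->
        (\int[P]_(w in B) (Y w)%:E = \int[P]_(w in B) (f w)%:E)%E].

(* A chosen version of E[f | G]: for f integrable and <<s G >> included in the
   measurable sets, one exists by Radon-Nikodym and any two are a.s. equal.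
   When there is none, the value is 0. *)
Definition cond_exp (G : set (set Omega)) (f : Omega -> R) : Omega -> R :=
  xget (cst 0) [set Y | is_cond_exp G f Y].

Definition cond_prob (G : set (set Omega)) (S : set Omega) : Omega -> R :=
  cond_exp G \1_S.

Definition cond_law (G : set (set Omega)) (T : ptopologicalType)
    (Y : Omega -> T) (B : set T) : Omega -> R :=
  cond_prob G (Y @^-1` B).

Definition sigma_of (T : ptopologicalType) (Z : Omega -> T) :
    set (set Omega) :=
  preimage_set_system setT Z (measurable : set (set (borelType T))).

Definition sigma_others (A : Type) (E0 : ptopologicalType)
    (E : A -> ptopologicalType) (Z : Omega -> E0)
    (X : forall a, Omega -> E a) (a : A) : set (set Omega) :=
  <<s sigma_of Z `|` \bigcup_(b in [set b | b <> a]) sigma_of (X b) >>.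

(* Two conditional laws are equal when they a.s. agree on each Borel set. As
   the Borel sets of a Polish space are countably generated, this is the same
   as a.s. equality of the regular conditional distributions. *)
Definition cond_independent (A : Type) (E0 : ptopologicalType)
    (E : A -> ptopologicalType) (Z : Omega -> E0)
    (X : forall a, Omega -> E a) : Prop :=
  forall (a : A) (B : set (E a)),
    (measurable : set (set (borelType (E a)))) B ->
    {ae P, forall w, cond_law (sigma_others Z X a) (X a) B w =
                     cond_law (sigma_of Z) (X a) B w}.

End conditioning.

(* Main.v *)
From HB Require Import structures.
Require Import Defs.
From mathcomp Require Import measurable_realfun ring lra.
Set Implicit Arguments.
Unset Strict Implicit.
Unset Printing Implicit Defensive.
Local Open Scope classical_set_scope.
Local Open Scope ring_scope.

(** The proof is a martingale argument along an enumeration of [A]. Write [f] for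
    [F \o joint X], [G n] for the sigma-algebra of [Z] and of the coordinates
    numbered below [n] ([explored]), and [M n] for the conditional expectation of
    [f] given [G n]; thus [M 0] is E(F(X) | Z).

    One step. Let [a] be the coordinate revealed between [G n] and [G n.+1], and
    let [h] be [F] evaluated with the coordinate [a] frozen at a constant, so that
    [`|f - h| <= d a]. As [h] does not depend on [X a], conditional independence
    gives it the same conditional expectation [V] given [G n] and given [G n.+1]
    ([cond_exp_frozen]). Hence [M n.+1 - M n = U' - U], where [U' = M n.+1 - V] and
    [U = M n - V] are the conditional expectations of [f - h], lie in
    [- d a, d a], and [U] is the projection of [U'] on [G n]. So, given [G n],
    the increment is a centred variable ranging over an interval of length
    [2 * d a], and Hoeffding's lemma bounds its exponential moment by
    [expR (s ^+ 2 * d a ^+ 2 / 2)]: below the chord of the exponential over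
    [- d a, d a] ([chord_expR]) everything is affine in [U'], which may be
    replaced by [U] ([expR_increment_le]).

    Many steps. Multiplying the one-step bounds and applying Markov's inequality
    on an event [B] of [Z] gives
    [P (B `&` [x <= M n - M 0]) <= expR (- s x + s^2 \sum d^2 / 2) * P B]
    ([azuma_expR], [chernoff]). If [A] is infinite, [f] is the limit of [M n] in L1
    ([martingale_L1_cvg]), because [f] is approximated in L1 by functions of [Z]
    and finitely many coordinates; [azuma_limit] passes to the limit in
    probability. Optimising [s] ([chernoff_optimal]) and letting [B] vary
    ([cond_prob_le]) turns this into the almost sure bound. *)

(** * Integration against a sub-sigma-algebra *)

Section sub_sigma_algebras.
Import HBSimple HBNNSimple.
Context {d : measure_display} {Omega : measurableType d} {R : realType}
  (P : probability Omega R).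
Implicit Types (G H : set (set Omega)) (f g h Y W : Omega -> R).

Lemma sub_ambient G : G `<=` measurable -> <<s G>> `<=` measurable.
Proof.
by move=> GO; apply: smallest_sub => //; exact: sigma_algebra_measurable.
Qed.

Lemma measurable_ambient G d' (T : measurableType d') (Y : Omega -> T) :
  G `<=` measurable -> measurable_fun [set: g_sigma_algebraType G] Y ->
  measurable_fun [set: Omega] Y.
Proof. by move=> GO mY mT B mB; apply: (sub_ambient GO); exact: mY. Qed.

Lemma measurable_coarser G H d' (T : measurableType d') (Y : Omega -> T) :
  <<s G>> `<=` <<s H>> -> measurable_fun [set: g_sigma_algebraType G] Y ->
  measurable_fun [set: g_sigma_algebraType H] Y.
Proof. by move=> GH mY mT B mB; apply: GH; exact: mY. Qed.

Lemma measurable_forget G : G `<=` measurable ->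
  measurable_fun [set: Omega] (id : Omega -> g_sigma_algebraType G).
Proof. by move=> GO _ B mB; rewrite setTI; exact: (sub_ambient GO). Qed.

Lemma integrable_measurable f :
  P.-integrable setT (EFin \o f) -> measurable_fun setT f.
Proof. by move=> fi; apply/measurable_EFinP; exact: measurable_int fi. Qed.

Lemma integrable_on (B : set Omega) f :
  measurable B -> P.-integrable setT (EFin \o f) -> P.-integrable B (EFin \o f).
Proof. by move=> mB; exact: integrableS. Qed.

Lemma integrable_sub f g :
  P.-integrable setT (EFin \o f) -> P.-integrable setT (EFin \o g) ->
  P.-integrable setT (EFin \o (f \- g)).
Proof.
by move=> fi gi; have := integrableB measurableT fi gi; apply: eq_integrable.
Qed.

Lemma integral_sub (B : set Omega) f g : measurable B ->
  P.-integrable setT (EFin \o f) -> P.-integrable setT (EFin \o g) ->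
  (\int[P]_(w in B) ((f \- g) w)%:E =
   \int[P]_(w in B) (f w)%:E - \int[P]_(w in B) (g w)%:E)%E.
Proof.
move=> mB fi gi; under eq_integral do rewrite EFinB.
rewrite integralB//; first exact: (integrable_on mB fi).
exact: (integrable_on mB gi).
Qed.

Lemma integral_indicM (B : set Omega) f :
  (\int[P]_(w in B) (f w)%:E = \int[P]_w (f w * \1_B w)%:E)%E.
Proof.
rewrite integral_mkcond; apply: eq_integral => w _.
by rewrite patchE indicE; case: ifP => _; rewrite ?mulr1 ?mulr0.
Qed.

Lemma integrable_indicM (B : set Omega) f : measurable B ->
  P.-integrable setT (EFin \o f) ->
  P.-integrable setT (fun w => (f w * \1_B w)%:E).
Proof.
move=> mB fi.
have := (integrable_mkcond (EFin \o f) mB).1 (integrable_on mB fi).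
apply: eq_integrable => // w _.
by rewrite patchE indicE; case: ifP => _; rewrite ?mulr1 ?mulr0.
Qed.

Lemma integral_eq0_dynkin (C : set (set Omega)) g : C `<=` measurable ->
  setI_closed C -> P.-integrable setT (EFin \o g) ->
  (\int[P]_w (g w)%:E = 0)%E ->
  (forall B, C B -> (\int[P]_(w in B) (g w)%:E = 0)%E) ->
  forall B, <<s C>> B -> (\int[P]_(w in B) (g w)%:E = 0)%E.
Proof.
move=> CO CI gi gT gC B.
pose nu : {charge set Omega -> \bar R} := induced_charge gi.
rewrite -setI_closed_g_dynkin_g_sigma_algebra//.
suff : <<d C>> `<=` [set B | measurable B /\ nu B = 0%E] by move=> /[apply] -[].
apply: smallest_sub => /=; last by move=> A CA; split; [exact: CO|exact: gC].
split=> [|A [mA nuA]|F tF mF] /=.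
- by split => //; exact: gT.
- split; first exact: measurableC.
  have := chargeD nu (@measurableT _ Omega) mA; rewrite setTI setTD => ->.
  have -> : nu A = 0%E by [].
  by rewrite sube0; exact: gT.
- have mFF n : measurable (F n) by case: (mF n).
  have mU : measurable (\bigcup_n F n) by exact: bigcupT_measurable.
  split => //.
  have /cvg_lim <- // := @charge_semi_sigma_additive _ _ _ nu F mFF tF mU.
  apply: lim_near_cst => //; apply: nearW => n.
  by rewrite big1// => i _; case: (mF i).
Qed.

(** For an indicator [W] the claim is the hypothesis; it extends by linearity to
    simple functions, and by dominated convergence, with [`|W * g|] as dominating
    function, to nonnegative [W]. *)
Lemma integral_mul_eq0_ge0 G g W : G `<=` measurable ->
  P.-integrable setT (EFin \o g) ->
  (forall B, <<s G>> B -> (\int[P]_(w in B) (g w)%:E = 0)%E) ->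
  measurable_fun [set: g_sigma_algebraType G] W -> (forall w, 0 <= W w) ->
  P.-integrable setT (fun w => (W w * g w)%:E) ->
  (\int[P]_w (W w * g w)%:E = 0)%E.
Proof.
move=> GO gi g0 mW W0 Wgi.
have mW' : measurable_fun [set: g_sigma_algebraType G] (EFin \o W).
  exact/measurable_EFinP.
pose phi := nnsfun_approx measurableT mW'.
have W0' : forall w, [set: g_sigma_algebraType G] w -> (0 <= (EFin \o W) w)%E.
  by move=> w _; rewrite lee_fin.
have mphi n : measurable_fun [set: Omega] (fun w : Omega => phi n w).
  by apply: (measurable_ambient GO); exact: (measurable_funP (phi n)).
have mg := integrable_measurable gi.
have phi_le n w : phi n w <= W w.
  by rewrite -lee_fin /phi nnsfun_approxE; exact: (@le_approx _ _ _ _ _ n w W0').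
have phi0 n : (\int[P]_w (phi n w * g w)%:E = 0)%E.
  have phiE w : ((phi n w * g w)%:E =
      \sum_(y <- finmap.enum_fset (fset_set (range (phi n))))
        (y%:E * ((g w)%:E * (\1_(phi n @^-1` [set y]) w)%:E)))%E.
    rewrite fimfunE fsbig_finite//= mulr_suml -sumEFin.
    by apply: eq_bigr => y _; rewrite -!EFinM; congr EFin; ring.
  under eq_integral do rewrite phiE.
  have mpre y : <<s G>> (phi n @^-1` [set y]).
    by have := measurable_funP (phi n) measurableT _ (measurable_set1 y);
      rewrite setTI.
  have mpreO y : measurable (phi n @^-1` [set y] : set Omega) by
    exact: (sub_ambient GO).
  rewrite integral_sum//; last first.
    move=> y; have := integrableZl measurableT y (integrable_indicM (mpreO y) gi).
    by [].
  rewrite big1// => y _.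
  rewrite integralZl//; last exact: integrable_indicM.
  by rewrite -integral_indicM g0 ?mule0.
have := @dominated_convergence _ _ _ P setT measurableT
  (fun n w => (phi n w * g w)%:E) (fun w => (W w * g w)%:E)
  (fun w => `|(W w * g w)%:E|%E).
have mpg n : measurable_fun [set: Omega] (fun w => (phi n w * g w)%:E).
  by apply/measurable_EFinP; exact: measurable_funM.
case=> //.
- exact: measurable_int Wgi.
- apply: aeW => w _; apply: cvg_EFin; first exact: nearW.
  apply: cvgMl.
  have := cvg_nnsfun_approx measurableT mW' W0' (x := w) I.
  by move/fine_cvgP => [_].
- exact: integrable_abse.
- apply: aeW => w n _ /=; rewrite lee_fin !normrM ler_wpM2r//.
  by rewrite !ger0_norm//; exact: le_trans (phi_le n w).
move=> _ _ /cvg_lim <- //.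
by apply: lim_near_cst => //; apply: nearW => n; exact: phi0.
Qed.

(** Integrability is asked of the product, because the lemma serves both for
    bounded [W] and for integrable [W] with [g] bounded. *)
Lemma integral_mul_eq0 G g W : G `<=` measurable ->
  P.-integrable setT (EFin \o g) ->
  (forall B, <<s G>> B -> (\int[P]_(w in B) (g w)%:E = 0)%E) ->
  measurable_fun [set: g_sigma_algebraType G] W ->
  P.-integrable setT (fun w => (W w * g w)%:E) ->
  (\int[P]_w (W w * g w)%:E = 0)%E.
Proof.
move=> GO gi g0 mW Wgi.
have mWp : measurable_fun [set: g_sigma_algebraType G] W^\+.
  exact: measurable_funrpos.
have mWn : measurable_fun [set: g_sigma_algebraType G] W^\-.
  exact: measurable_funrneg.
have mg := integrable_measurable gi.
have part (V : Omega -> R) : measurable_fun [set: g_sigma_algebraType G] V ->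
    (forall w, `|V w| <= `|W w|) ->
    P.-integrable setT (fun w => (V w * g w)%:E).
  move=> mV VW; apply: (le_integrable _ _ _ Wgi) => //.
    apply/measurable_EFinP/measurable_funM => //; exact: measurable_ambient mV.
  by move=> w _ /=; rewrite lee_fin !normrM ler_wpM2r.
have pnE w : `|W w| = W^\+ w + W^\- w.
  by have /(congr1 (@^~ w))/= <- := funrposDneg W.
have ip : P.-integrable setT (fun w => (W^\+ w * g w)%:E).
  apply: part => // w; rewrite pnE ger0_norm ?funrpos_ge0//.
  by rewrite lerDl funrneg_ge0.
have in_ : P.-integrable setT (fun w => (W^\- w * g w)%:E).
  apply: part => // w; rewrite pnE ger0_norm ?funrneg_ge0//.
  by rewrite lerDr funrpos_ge0.
have WE w : ((W w * g w)%:E = (W^\+ w * g w)%:E - (W^\- w * g w)%:E)%E.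
  by rewrite -EFinB -mulrBl -[in LHS](funrposBneg W).
under eq_integral do rewrite WE.
rewrite integralB//.
rewrite (integral_mul_eq0_ge0 GO gi g0 mWp (funrpos_ge0 W) ip).
by rewrite (integral_mul_eq0_ge0 GO gi g0 mWn (funrneg_ge0 W) in_) subee.
Qed.

(** The event [g < 0] is itself one of the test events. *)
Lemma ae_ge0 G g : G `<=` measurable ->
  measurable_fun [set: g_sigma_algebraType G] g ->
  P.-integrable setT (EFin \o g) ->
  (forall B, <<s G>> B -> (0 <= \int[P]_(w in B) (g w)%:E)%E) ->
  {ae P, forall w, 0 <= g w}.
Proof.
move=> GO mg gi g0.
pose B := [set w | g w < 0].
have sB : <<s G>> B.
  have := mg measurableT [set` `]-oo, (0:R)[ ] (measurable_itv _); rewrite setTI.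
  by congr (_ _); apply/seteqP; split => w /=; rewrite /B in_itv.
have mB := sub_ambient GO sB.
have mgB : measurable_fun B (EFin \o g).
  by apply: (measurable_funS measurableT) => //; exact: measurable_int gi.
have absE : (\int[P]_(w in B) `|(g w)%:E| = - \int[P]_(w in B) (g w)%:E)%E.
  rewrite -integralN; last first.
    by apply: integrable_add_def => //; exact: (integrable_on mB gi).
  by apply: eq_integral => w; rewrite inE => Bw /=; rewrite ltr0_norm.
have : (\int[P]_(w in B) `|(g w)%:E| = 0)%E.
  by apply/eqP; rewrite eq_le integral_ge0// andbT absE oppe_le0 g0.
move/(ae_eq_integral_abs P mB mgB); apply: filterS => w /= Bw.
rewrite leNgt; apply/negP => gw0.
by move: (Bw gw0) => [] g0w; rewrite g0w ltxx in gw0.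
Qed.

(** * Conditional expectations *)

(** Radon-Nikodym on the sub-sigma-algebra generated by [G], for the charge
    with density [f]. *)
Lemma cond_exp_exists G f : G `<=` measurable ->
  P.-integrable setT (EFin \o f) -> exists Y, is_cond_exp P G f Y.
Proof.
move=> GO fi.
pose id' : Omega -> g_sigma_algebraType G := id.
have mid : measurable_fun setT id' by exact: measurable_forget.
pose idf : {mfun Omega >-> g_sigma_algebraType G} :=
  HB.pack id' (isMeasurableFun.Build _ _ _ _ _ mid).
have [nu nuE] : exists nu : {charge set (g_sigma_algebraType G) -> \bar R},
    forall A, nu A = (\int[P]_(w in A) (f w)%:E)%E.
  by unshelve eexists (pushforward (induced_charge fi) id' :
    {charge set (g_sigma_algebraType G) -> \bar R}).
pose mu : {sigma_finite_measure set (g_sigma_algebraType G) -> \bar R} :=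
  distribution P idf.
have numu : nu `<< mu.
  apply/null_content_dominatesP => A mA muA0; rewrite nuE.
  apply: (@null_set_integral _ Omega _ P A) => //; first exact: (sub_ambient GO).
  by apply: (measurable_funS measurableT) => //; exact: measurable_int fi.
pose Y := fine \o Radon_Nikodym nu mu.
have YE : EFin \o Y = Radon_Nikodym nu mu.
  by apply/funext => w /=; rewrite fineK// Radon_Nikodym_fin_num.
have mY : measurable_fun [set: g_sigma_algebraType G] Y.
  apply/measurable_EFinP; rewrite YE.
  exact: (measurable_int _ (Radon_Nikodym_integrable numu)).
have mYO : measurable_fun [set: Omega] (EFin \o Y).
  by apply/measurable_EFinP; exact: measurable_ambient mY.
have Yi : P.-integrable setT (EFin \o Y).
  apply/integrableP; split => //.
  have := Radon_Nikodym_integrable numu.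
  rewrite -YE => /integrableP[mY']; rewrite ge0_integral_pushforward//.
  by apply: measurableT_comp.
exists Y; split => // B sB.
rewrite -nuE (Radon_Nikodym_integral numu)// -YE integral_pushforward//.
  by apply/measurable_EFinP.
by apply: integrable_on => //; exact: (sub_ambient GO).
Qed.

Lemma cond_expP G f : G `<=` measurable -> P.-integrable setT (EFin \o f) ->
  is_cond_exp P G f (cond_exp P G f).
Proof. by move=> GO fi; apply: xgetPex; exact: cond_exp_exists. Qed.

Lemma residual_eq0 G f Y : G `<=` measurable ->
  P.-integrable setT (EFin \o f) -> is_cond_exp P G f Y ->
  forall B, <<s G>> B -> (\int[P]_(w in B) ((f \- Y) w)%:E = 0)%E.
Proof.
move=> GO fi [_ Yi YE] B sB; have mB := sub_ambient GO sB.
rewrite integral_sub// YE// subee//.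
by apply: integrable_fin_num => //; exact: (integrable_on mB fi).
Qed.

Lemma is_cond_expB G f Y h W :
  P.-integrable setT (EFin \o f) -> P.-integrable setT (EFin \o h) ->
  G `<=` measurable ->
  is_cond_exp P G f Y -> is_cond_exp P G h W ->
  is_cond_exp P G (f \- h) (Y \- W).
Proof.
move=> fi hi GO [mY Yi YE] [mW Wi WE]; split.
- exact: measurable_funB.
- exact: integrable_sub.
- move=> B sB; have mB := sub_ambient GO sB.
  by rewrite !integral_sub// YE// WE.
Qed.

Lemma cond_exp_le G f Y c : G `<=` measurable ->
  P.-integrable setT (EFin \o f) -> is_cond_exp P G f Y ->
  (forall w, f w <= c) -> {ae P, forall w, Y w <= c}.
Proof.
move=> GO fi [mY Yi YE] fc.
have ci : P.-integrable setT (EFin \o cst c) by exact: finite_measure_integrable_cst.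
have : {ae P, forall w, 0 <= c - Y w}.
  apply: (@ae_ge0 G (cst c \- Y)) => //.
  - exact: measurable_funB.
  - exact: integrable_sub.
  - move=> B sB; have mB := sub_ambient GO sB.
    rewrite integral_sub// YE// -integral_sub//.
    by apply: integral_ge0 => w _; rewrite lee_fin subr_ge0.
by apply: filterS => w; rewrite subr_ge0.
Qed.

Lemma cond_exp_norm_le G f Y c : G `<=` measurable ->
  P.-integrable setT (EFin \o f) -> is_cond_exp P G f Y ->
  (forall w, `|f w| <= c) -> {ae P, forall w, `|Y w| <= c}.
Proof.
move=> GO fi YE fc.
have h1 : {ae P, forall w, Y w <= c}.
  by apply: (cond_exp_le GO fi YE) => w; have := fc w; rewrite ler_norml => /andP[].
have h2 : {ae P, forall w, 0 - Y w <= c}.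
  have zi : P.-integrable setT (EFin \o cst (0:R)) by
    exact: finite_measure_integrable_cst.
  have z : is_cond_exp P G (cst 0) (cst 0) by split.
  have := is_cond_expB zi fi GO z YE.
  move/(cond_exp_le GO); apply; first exact: integrable_sub.
  by move=> w /=; have := fc w; rewrite ler_norml sub0r lerNl => /andP[].
apply: filterS2 h1 h2 => w; rewrite sub0r ler_norml => -> /=.
by rewrite lerNl => ->.
Qed.

(** Test against the sign of [U], which is measurable for [G]. *)
Lemma cond_exp_L1 G f U : G `<=` measurable ->
  P.-integrable setT (EFin \o f) -> is_cond_exp P G f U ->
  (\int[P]_w `|U w|%:E <= \int[P]_w `|f w|%:E)%E.
Proof.
move=> GO fi HU; have [mU Ui UI] := HU.
have mUO := integrable_measurable Ui; have mf := integrable_measurable fi.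
pose B := [set w | 0 <= U w].
have sB : <<s G>> B.
  rewrite -[B]setTI; apply: (@measurable_fun_le _ (g_sigma_algebraType G) R) => //.
pose W w : R := 2 * \1_B w - 1.
have WU w : `|U w| = W w * U w.
  rewrite /W indicE; case: (boolP (w \in B)) => [/set_mem|].
    by rewrite /B/= => Uw; rewrite ger0_norm//; ring.
  by rewrite notin_setE /B/= => /negP; rewrite -ltNge => Uw; rewrite ltr0_norm//; ring.
have W1 w : `|W w| = 1.
  rewrite /W indicE; case: (w \in B) => /=.
    by rewrite mulr1 (_ : 2 - 1 = 1 :> R) ?normr1//; ring.
  by rewrite mulr0 sub0r normrN1.
have mW : measurable_fun [set: g_sigma_algebraType G] W.
  by apply: measurable_funB => //; apply: measurable_funM.
have mWO := measurable_ambient GO mW.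
have Wi h : P.-integrable setT (EFin \o h) ->
    P.-integrable setT (fun w => (W w * h w)%:E).
  move=> hi; apply: (le_integrable _ _ _ hi) => //.
    by apply/measurable_EFinP/measurable_funM => //; exact: integrable_measurable hi.
  by move=> w _ /=; rewrite normrM W1 mul1r.
under eq_integral do rewrite WU.
have fUi := integrable_sub fi Ui.
have -> : (\int[P]_w (W w * U w)%:E = \int[P]_w (W w * f w)%:E)%E.
  apply/eqP; rewrite eq_sym -[eqbRHS]add0e.
  rewrite -(integral_mul_eq0 GO fUi (residual_eq0 GO fi HU) mW (Wi _ fUi)).
  rewrite -integralD//; [|exact: Wi|exact: Wi].
  by apply/eqP/eq_integral => w _; rewrite -EFinD /=; congr EFin; ring.
apply: le_integral; [by []|exact: Wi|exact: integrable_norm|].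
by move=> w _; rewrite lee_fin (le_trans (ler_norm _))// normrM W1 mul1r.
Qed.

End sub_sigma_algebras.

(** * The exponential bound of Hoeffding *)

Lemma nonneg_of_derive_ge0 (R : realType) (f f' : R -> R) :
  f 0 = 0 -> (forall t, is_derive (t : R) (1 : R) f (f' t)) ->
  (forall t : R, 0 <= t -> 0 <= f' t) -> forall t : R, 0 <= t -> 0 <= f t.
Proof.
move=> f0 df f'_ge0 t t0; rewrite -f0.
apply: (@ger0_derive1_ndecry _ f 0) => //.
- move=> x; rewrite in_itv/= andbT => x0.
  by rewrite derive1E; case: (df x) => _ ->; exact/f'_ge0/ltW.
- apply: continuous_subspaceT => x; apply: differentiable_continuous.
  by apply/derivable1_diffP; case: (df x).
Qed.

(** The difference [D t] of the two sides satisfies [D'' >= D] with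
    [D 0 = D' 0 = 0]. In the factored form [(d/dt + 1) (d/dt - 1)] of the
    second-order operator this is two monotonicity arguments, one for
    [k t = expR t * (D' t - D t)] and one for [h t = expR (- t) * D t]. *)
Lemma expR_cosh_sinh_le (R : realType) (v t : R) : 0 <= t ->
  (expR t + expR (- t)) / 2 + v * ((expR t - expR (- t)) / 2)
    <= expR (t * v + t ^+ 2 / 2).
Proof.
pose k (t : R) := (v + t - 1) * expR (t * (v + 1) + t ^+ 2 / 2) + 1 - v.
pose h (t : R) := expR (t * (v - 1) + t ^+ 2 / 2)
   - (1 + expR (- 2 * t)) / 2 - v * ((1 - expR (- 2 * t)) / 2).
have k_ge0 s : 0 <= s -> 0 <= k s.
  apply: (@nonneg_of_derive_ge0 _ k
    (fun s => (v + s) ^+ 2 * expR (s * (v + 1) + s ^+ 2 / 2))).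
  - by rewrite /k mul0r expr0n mul0r !addr0 expR0; ring.
  - move=> r; rewrite /k; apply: is_derive_eq; rewrite /GRing.scale/=.
    by field.
  - by move=> r _; rewrite mulr_ge0 ?sqr_ge0 ?expR_ge0.
move=> t0.
have : 0 <= h t.
  move: t t0; apply: (@nonneg_of_derive_ge0 _ h
    (fun s => expR (- 2 * s) * k s)).
  - rewrite /h mulr0 mul0r expr0n mul0r !addr0 expR0; lra.
  - move=> r; rewrite /h; apply: is_derive_eq; rewrite /GRing.scale/= /k.
    have -> : r * (v + 1) + r ^+ 2 / 2 = 2 * r + (r * (v - 1) + r ^+ 2 / 2).
      by field.
    have e : expR (- 2 * r) * expR (2 * r) = 1 by rewrite -expRD mulNr addNr expR0.
    rewrite (expRD (2 * r)); move: e.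
    set a := expR (- 2 * r); set b := expR (2 * r).
    set c := expR (r * (v - 1) + _) => e.
    have -> : a * ((v + r - 1) * (b * c) + 1 - v) =
      (v + r - 1) * c * (a * b) + a * (1 - v) by ring.
    by rewrite e /c; field.
  - by move=> s s0; rewrite mulr_ge0 ?expR_ge0 ?k_ge0.
have -> : expR (t * v + t ^+ 2 / 2) =
    expR t * expR (t * (v - 1) + t ^+ 2 / 2).
  by rewrite -expRD; congr expR; ring.
have -> : expR (- t) = expR t * expR (- 2 * t).
  by rewrite -expRD; congr expR; ring.
rewrite -(@pmulr_rge0 _ (expR t) (h t)) ?expR_gt0// => ht.
rewrite -subr_ge0.
apply: (le_trans ht); rewrite le_eqVlt; apply/orP; left; apply/eqP; rewrite /h.
by field.
Qed.

(** Hoeffding's lemma for a variable in [-c, c] with mean [v], in pointwise form: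
    the affine function is the chord of [u |-> expR (s * u)] over [-c, c], with
    slope [sinh (s * c) / c], which division by zero makes 0 for [c = 0]. *)
Lemma chord_expR (R : realType) (s c : R) : 0 <= s -> 0 <= c ->
  exists a b : R,
    (forall u, `|u| <= c -> expR (s * u) <= a + b * u) /\
    (forall v, `|v| <= c -> a + b * v <= expR (s * v + (s * c) ^+ 2 / 2)).
Proof.
move=> s0 c0.
exists ((expR (s * c) + expR (- (s * c))) / 2),
       ((expR (s * c) - expR (- (s * c))) / 2 / c).
split=> [u|v].
  have [->|cn0 uc] := eqVneq c 0.
    rewrite normr_le0 => /eqP ->.
    by rewrite !mulr0 oppr0 expR0 addr0; lra.
  have c_gt0 : 0 < c by rewrite lt_neqAle eq_sym cn0.
  have tp : 0 <= (c - u) / (2 * c) <= 1.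
    move: uc; rewrite ler_norml => /andP[? ?]; apply/andP; split.
      by rewrite divr_ge0//; lra.
    by rewrite ler_pdivrMr; lra.
  (* [u] is a barycentre of [-c] and [c]. *)
  have := @convex_expR R (Itv01 (andP tp).1 (andP tp).2) (- (s * c)) (s * c).
  rewrite !convRE/= /unstable.onem => h.
  have -> : s * u = (c - u) / (2 * c) * - (s * c) +
      (1 - (c - u) / (2 * c)) * (s * c) by field.
  by apply: (le_trans h); rewrite le_eqVlt; apply/orP; left; apply/eqP; field.
have := @expR_cosh_sinh_le R (v / c) (s * c) (mulr_ge0 s0 c0).
have [->|cn0 h vc] := eqVneq c 0.
  move=> _; rewrite normr_le0 => /eqP ->.
  by rewrite !mulr0 oppr0 expR0 addr0 expr0n/= mul0r addr0 expR0; lra.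
have -> : s * v = s * c * (v / c) by field.
apply: le_trans h; rewrite le_eqVlt; apply/orP; left; apply/eqP; by field.
Qed.

(** * Martingales with bounded increments *)

Section increment.
Context {d : measure_display} {Omega : measurableType d} {R : realType}
  (P : probability Omega R).
Implicit Types (G H : set (set Omega)) (f g h Y W : Omega -> R).

Lemma ae_le_integrable f g : measurable_fun setT f ->
  P.-integrable setT (EFin \o g) -> {ae P, forall w, `|f w| <= `|g w|} ->
  P.-integrable setT (EFin \o f).
Proof.
move=> mf gi fg; have mg := integrable_measurable gi.
apply/integrableP; split; first exact/measurable_EFinP.
have /integrableP[_] := gi; apply: le_lt_trans.
apply: ae_ge0_le_integral => //.
- by apply: measurableT_comp => //; exact/measurable_EFinP.
- by apply: measurableT_comp => //; exact/measurable_EFinP.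
- by apply: filterS fg => w fgw _; rewrite lee_fin.
Qed.

Lemma ae_le_integral f g :
  P.-integrable setT (EFin \o f) -> P.-integrable setT (EFin \o g) ->
  {ae P, forall w, f w <= g w} ->
  (\int[P]_w (f w)%:E <= \int[P]_w (g w)%:E)%E.
Proof.
move=> fi gi fg.
rewrite -sube_ge0; last by rewrite (integrable_fin_num measurableT gi) orbT.
rewrite -integralB//.
have mgf : measurable_fun setT (fun w => (g w)%:E - (f w)%:E)%E.
  by apply: emeasurable_funB; [exact: measurable_int gi|exact: measurable_int fi].
rewrite (ae_eq_integral (fun w => `|(g w)%:E - (f w)%:E|%E))//.
- exact: integral_ge0.
- exact: measurableT_comp.
- by apply: filterS fg => w fgw _ /=; rewrite ger0_norm ?subr_ge0.
Qed.

(** One step of the martingale. Subtracting [h], whose projections on the two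
    sigma-algebras coincide, turns the increment [Y' - Y] into [U' - U], where
    [U'] and [U] are the projections of [f - h] and thus lie in [-c, c]. Below
    the chord of [u |-> expR (s * u)] the dependence on [U'] is affine, so that
    [U'] may be replaced by its conditional expectation [U]. *)
Lemma expR_increment_le G H f h Y Y' V W (c s : R) :
  G `<=` measurable -> H `<=` measurable -> <<s G>> `<=` <<s H>> ->
  P.-integrable setT (EFin \o f) -> P.-integrable setT (EFin \o h) ->
  (forall w, `|f w - h w| <= c) ->
  is_cond_exp P G f Y -> is_cond_exp P H f Y' ->
  is_cond_exp P G h V -> is_cond_exp P H h V ->
  measurable_fun [set: g_sigma_algebraType G] W -> (forall w, 0 <= W w) ->
  P.-integrable setT (EFin \o W) -> 0 <= s -> 0 <= c ->
  P.-integrable setT (fun w => (W w * expR (s * (Y' w - Y w)))%:E) /\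
  (\int[P]_w (W w * expR (s * (Y' w - Y w)))%:E <=
    (expR ((s * c) ^+ 2 / 2))%:E * \int[P]_w (W w)%:E)%E.
Proof.
move=> GO HO GH fi hi fhc GY HY' GV HV mW W0 Wi s0 c0.
have fhi := integrable_sub fi hi.
have GU := is_cond_expB fi hi GO GY GV; have HU' := is_cond_expB fi hi HO HY' HV.
have Uc := cond_exp_norm_le GO fhi GU fhc.
have U'c := cond_exp_norm_le HO fhi HU' fhc.
pose U := Y \- V; pose U' := Y' \- V.
rewrite -/U in GU Uc; rewrite -/U' in HU' U'c.
have UE w : Y' w - Y w = U' w - U w by rewrite /U /U' /=; ring.
have [mU Ui UI] := GU; have [mU' U'i U'I] := HU'.
have mWO := integrable_measurable Wi.
have mUO := integrable_measurable Ui; have mU'O := integrable_measurable U'i.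
have ei (F : Omega -> R) (C : R) : measurable_fun setT F ->
    {ae P, forall w, `|F w| <= C} ->
    P.-integrable setT (EFin \o (fun w => W w * F w)).
  move=> mF FC; have CWi := integrableZl measurableT C Wi.
  apply: (@ae_le_integrable _ (fun w => C * W w)) => //.
    exact: measurable_funM.
  apply: filterS FC => w FwC; rewrite !normrM mulrC ler_wpM2r//.
  exact: le_trans FwC (ler_norm _).
have expc (t u : R) : `|u| <= c -> 0 <= t -> expR (t * u) <= expR (t * c).
  by move=> uc t0; rewrite ler_expR ler_wpM2l//; exact: le_trans (ler_norm _) uc.
have mexp (F : Omega -> R) (t : R) : measurable_fun setT F ->
    measurable_fun setT (fun w => expR (t * F w)).
  move=> mF; apply: measurableT_comp => //; exact: measurable_funM.
have [a [b [chord_ge chord_le]]] := chord_expR s0 c0.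
pose E w := expR (- s * U w).
have mE : measurable_fun setT E by exact: mexp.
have E_le : {ae P, forall w, `|E w| <= expR (s * c)}.
  apply: filterS Uc => w Uw; rewrite ger0_norm ?expR_ge0// /E mulNr -mulrN.
  by apply: expc => //; rewrite normrN.
have ab_le (F : Omega -> R) : measurable_fun setT F ->
    {ae P, forall w, `|F w| <= c} ->
    P.-integrable setT (EFin \o (fun w => W w * (E w * (a + b * F w)))).
  move=> mF Fc; apply: (ei _ (expR (s * c) * (`|a| + `|b| * c))).
    apply: measurable_funM => //; apply: measurable_funD => //.
    exact: measurable_funM.
  apply: filterS2 E_le Fc => w Ew Fw; rewrite normrM ler_pM//.
  by rewrite (le_trans (ler_normD _ _))// lerD2l normrM ler_wpM2l.
have lhsi : P.-integrable setT
    (EFin \o (fun w => W w * expR (s * (Y' w - Y w)))).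
  apply: (ei _ (expR (s * c) * expR (s * c))).
    have [[mY _ _] [mY' _ _]] := (GY, HY').
    by apply: mexp; apply: measurable_funB;
      [exact: measurable_ambient mY'|exact: measurable_ambient mY].
  apply: filterS2 Uc U'c => w Uw U'w; rewrite ger0_norm ?expR_ge0//.
  rewrite UE mulrBr expRD ler_pM ?expR_ge0 ?expc//.
  by rewrite -mulrN expc ?normrN.
split=> //.
have -> : ((expR ((s * c) ^+ 2 / 2))%:E * \int[P]_w (W w)%:E =
    \int[P]_w (W w * expR ((s * c) ^+ 2 / 2))%:E)%E.
  by rewrite -integralZl//; apply: eq_integral => w _; rewrite -EFinM mulrC.
apply: (@le_trans _ _ (\int[P]_w (W w * (E w * (a + b * U' w)))%:E)%E).
  apply: ae_le_integral => //; first exact: ab_le.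
  apply: filterS U'c => w U'w; rewrite ler_wpM2l// UE mulrBr addrC expRD -mulNr.
  by rewrite ler_wpM2l ?expR_ge0//; exact: chord_ge.
pose K w := b * (W w * E w) * (U' w - U w).
have Ki : P.-integrable setT (EFin \o K).
  have := integrable_sub (ab_le _ mU'O U'c) (ab_le _ mUO Uc).
  by apply: eq_integrable => // w _ /=; rewrite /K; congr EFin; ring.
have -> : (\int[P]_w (W w * (E w * (a + b * U' w)))%:E =
    \int[P]_w (W w * (E w * (a + b * U w)))%:E)%E.
  transitivity (\int[P]_w ((W w * (E w * (a + b * U w)))%:E + (K w)%:E))%E.
    by apply: eq_integral => w _; rewrite -EFinD /K; congr EFin; ring.
  rewrite integralD//; last exact: ab_le.
  rewrite [X in (_ + X)%E](integral_mul_eq0 GO) ?adde0//.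
  - exact: integrable_sub.
  - move=> B sB; have mB := sub_ambient GO sB.
    rewrite integral_sub// UI// U'I ?subee//; last exact: GH.
    by apply: integrable_fin_num => //; exact: (integrable_on mB fhi).
  - apply: measurable_funM => //; apply: measurable_funM => //.
    by apply: measurableT_comp => //; exact: measurable_funM.
apply: ae_le_integral => //; first exact: ab_le.
  apply: (ei _ (expR ((s * c) ^+ 2 / 2))) => //.
  by apply: aeW => w; rewrite ger0_norm ?expR_ge0.
apply: filterS Uc => w Uw; rewrite ler_wpM2l//.
have -> : expR ((s * c) ^+ 2 / 2) = E w * expR (s * U w + (s * c) ^+ 2 / 2).
  by rewrite /E -expRD; congr expR; ring.
by rewrite ler_wpM2l ?expR_ge0//; exact: chord_le.
Qed.

End increment.

Section azuma.
Context {d : measure_display} {Omega : measurableType d} {R : realType}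
  (P : probability Omega R).
Variables (G : nat -> set (set Omega)) (f : Omega -> R)
  (M : nat -> Omega -> R) (c : nat -> R).
Hypothesis GO : forall n, G n `<=` measurable.
Hypothesis Gmono : forall n, <<s G n>> `<=` <<s G n.+1>>.
Hypothesis fi : P.-integrable setT (EFin \o f).
Hypothesis GM : forall n, is_cond_exp P (G n) f (M n).
Hypothesis c_ge0 : forall n, 0 <= c n.
Hypothesis increment : forall n, exists h V,
  [/\ P.-integrable setT (EFin \o h), forall w, `|f w - h w| <= c n,
      is_cond_exp P (G n) h V & is_cond_exp P (G n.+1) h V].

Lemma filtration_le m n : (m <= n)%N -> <<s G m>> `<=` <<s G n>>.
Proof.
elim: n => [|n IHn]; first by rewrite leqn0 => /eqP ->.
rewrite leq_eqVlt => /predU1P[->//|/IHn mn].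
by apply: (subset_trans mn); exact: Gmono.
Qed.

Lemma measurable_martingale n : measurable_fun setT (M n).
Proof. by have [/(measurable_ambient (@GO n))] := GM n. Qed.

(** A bound conditional on [G 0] is stated by testing it on all events [B] of
    [G 0]. *)
Lemma azuma_expR (B : set Omega) (s : R) (n : nat) : <<s G 0>> B -> 0 <= s ->
  P.-integrable setT (fun w => (\1_B w * expR (s * (M n w - M 0 w)))%:E) /\
  (\int[P]_w (\1_B w * expR (s * (M n w - M 0 w)))%:E <=
   (expR (s ^+ 2 * (\sum_(k < n) c k ^+ 2) / 2))%:E * P B)%E.
Proof.
move=> sB s0; have mB := sub_ambient (@GO 0) sB.
elim: n => [|n [IHi IHle]].
  have E w : \1_B w * expR (s * (M 0 w - M 0 w)) = \1_B w :> R.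
    by rewrite subrr mulr0 expR0 mulr1.
  under eq_integral do rewrite E.
  split; first by under eq_fun do rewrite E; exact: integrable_indic.
  by rewrite big_ord0 mulr0 mul0r expR0 mul1e integral_indic// setIT.
have [h [V [hi hc hV hV']]] := increment n.
pose W w : R := \1_B w * expR (s * (M n w - M 0 w)).
have mW : measurable_fun [set: g_sigma_algebraType (G n)] W.
  apply: measurable_funM.
    by apply: measurable_indic; exact: (filtration_le (leq0n n)).
  apply: measurableT_comp => //; apply: measurable_funM => //.
  apply: measurable_funB; first by case: (GM n).
  by apply: (measurable_coarser (filtration_le (leq0n n))); case: (GM 0).
have W0 w : 0 <= W w by rewrite mulr_ge0 ?expR_ge0// indicE.
have [Wi Wle] := expR_increment_le (@GO n) (@GO n.+1) (@Gmono n) fi hi hc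
  (GM n) (GM n.+1) hV hV' mW W0 IHi s0 (c_ge0 n).
have WE : (fun w => (W w * expR (s * (M n.+1 w - M n w)))%:E) =
    (fun w => (\1_B w * expR (s * (M n.+1 w - M 0 w)))%:E).
  apply/funext => w; rewrite /W -mulrA -expRD; congr (_ * expR _)%:E; ring.
rewrite WE in Wi Wle; split => //; apply: (le_trans Wle).
apply: (@le_trans _ _ ((expR ((s * c n) ^+ 2 / 2))%:E *
  ((expR (s ^+ 2 * (\sum_(k < n) c k ^+ 2) / 2))%:E * P B))%E).
  by rewrite lee_wpmul2l// lee_fin expR_ge0.
rewrite muleA -EFinM -expRD big_ord_recr/=.
by rewrite le_eqVlt; apply/orP; left; apply/eqP; congr ((expR _)%:E * _)%E; field.
Qed.

Lemma chernoff (B : set Omega) (s y : R) (n : nat) : <<s G 0>> B -> 0 <= s ->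
  (P (B `&` [set w | (y <= M n w - M 0 w)%R]) <=
   (expR (- (s * y) + s ^+ 2 * (\sum_(k < n) c k ^+ 2) / 2))%:E * P B)%E.
Proof.
move=> sB s0; have mB := sub_ambient (@GO 0) sB.
set D := _ `&` _.
have mD : measurable D.
  apply: measurable_fun_le => //; apply: measurable_funTS.
  exact: measurable_funB (measurable_martingale _) (measurable_martingale _).
have [Wi Wle] := azuma_expR n sB s0.
rewrite expRD EFinM -muleA.
apply: (@le_trans _ _ ((expR (- (s * y)))%:E *
  \int[P]_w (\1_B w * expR (s * (M n w - M 0 w)))%:E)%E); last first.
  by rewrite lee_wpmul2l// lee_fin expR_ge0.
rewrite -integralZl// -[X in P X](setIT D) -integral_indic//.
apply: ge0_le_integral => //.
- exact/measurable_EFinP/measurable_indic.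
- by apply: emeasurable_funM => //; exact: measurable_int Wi.
move=> w _; rewrite -EFinM lee_fin mulrCA -expRD.
rewrite /D indicI/= -[leLHS]mulr1; case: (boolP (w \in B)) => wB; last first.
  by rewrite !indicE (negbTE wB) !mul0r.
rewrite [\1_B w]indicE wB !mul1r mulr1.
rewrite indicE; case: (boolP (w \in _)) => [|_]; last exact: expR_ge0.
rewrite inE/= => yw; rewrite -expR0 ler_expR addrC subr_ge0.
by rewrite ler_wpM2l.
Qed.

(** The martingale may be replaced by its limit [f]: the event [x <= f - M 0] is
    contained in [x - e <= M n - M 0] up to the event [e <= |f - M n|], which
    Markov's inequality controls. *)
Lemma azuma_limit (S : R) (B : set Omega) (s x : R) :
  (forall n, \sum_(k < n) c k ^+ 2 <= S) ->
  (forall e : R, 0 < e -> exists n, (\int[P]_w `|f w - M n w|%:E <= e%:E)%E) ->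
  <<s G 0>> B -> 0 <= s ->
  (P (B `&` [set w | (x <= f w - M 0 w)%R]) <=
   (expR (- (s * x) + s ^+ 2 * S / 2))%:E * P B)%E.
Proof.
move=> cS fM sB s0; have mB := sub_ambient (@GO 0) sB.
have mf := integrable_measurable fi.
set D := B `&` _; set K := expR _.
have mD : measurable D.
  apply: measurable_fun_le => //; apply: measurable_funTS.
  exact: measurable_funB (measurable_martingale 0).
have step e : 0 < e -> (P D <= (expR (s * e) * K)%:E * P B)%E.
  move=> e0; apply/lee_addgt0Pr => eta eta0.
  have [n fMn] := fM _ (mulr_gt0 e0 eta0).
  pose D1 := B `&` [set w | x - e <= M n w - M 0 w].
  pose D2 := [set w | e <= `|f w - M n w|].
  have mfM : measurable_fun setT (fun w => f w - M n w).
    exact: measurable_funB (measurable_martingale n).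
  have mD1 : measurable D1.
    apply: measurable_fun_le => //; apply: measurable_funTS.
    exact: measurable_funB (measurable_martingale _) (measurable_martingale _).
  have mD2 : measurable D2.
    rewrite -[D2]setTI; apply: measurable_fun_le => //.
    exact: measurableT_comp.
  apply: (@le_trans _ _ (P (D1 `|` D2))).
    apply: le_measure; rewrite ?inE//; first exact: measurableU.
    move=> w [Bw /= xw]; have [ew|we] := leP e `|f w - M n w|; first by right.
    left; split => //=; have := le_lt_trans (ler_norm _) we; lra.
  apply: (le_trans (measureU2 _ _ _)) => //; apply: leeD.
    apply: (le_trans (chernoff (x - e) n sB s0)).
    rewrite lee_wpmul2r// lee_fin /K -expRD ler_expR.
    have := ler_wpM2l (sqr_ge0 s) (cS n); lra.
  have mfME : measurable_fun setT (EFin \o (fun w => f w - M n w)).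
    exact/measurable_EFinP.
  have := le_integral_abse P measurableT mfME e0.
  rewrite setTI => /le_trans/(_ fMn).
  by rewrite EFinM lee_pmul2l ?lte_fin.
have PDfin : P D \is a fin_num by exact: fin_num_measure.
have PBfin : P B \is a fin_num by exact: fin_num_measure.
have PD1 : fine (P D) <= 1 by rewrite -lee_fin fineK// probability_le1.
have PD0 : 0 <= fine (P D) by rewrite fine_ge0.
rewrite -(fineK PDfin) -(fineK PBfin) -EFinM lee_fin.
(* Let [e] tend to 0 in [step]: since [expR (- t) >= 1 - t] and [P D <= 1],
   the error is at most [t = s * (e / (s + 1)) <= e]. *)
apply/ler_addgt0Pr => e e0.
have s1 : 0 < s + 1 by rewrite ltr_wpDl.
have := step _ (divr_gt0 e0 s1).
rewrite -(fineK PDfin) -(fineK PBfin) -EFinM lee_fin /=.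
set t := s * _; set p := fine _; set q := K * fine (P B) => pq.
have te : t <= e.
  by rewrite /t mulrCA ger_pMr// ler_pdivrMr// mul1r lerDl.
have : p * expR (- t) <= q.
  rewrite expRN ler_pdivrMr ?expR_gt0// (le_trans pq)// /q.
  by rewrite -mulrA mulrC.
have := expR_ge1Dx (- t).
have t0 : 0 <= t by rewrite mulr_ge0// divr_ge0// ltW.
move=> h1 h2.
have h3 : p * (1 - t) <= q by apply: le_trans h2; rewrite ler_wpM2l.
have : p * t <= t by rewrite ler_piMl.
by lra.
Qed.

End azuma.

(** * Convergence of the martingale in L1 *)

Section approximation.
Import HBSimple.
Context {d : measure_display} {Omega : measurableType d} {R : realType}
  (P : probability Omega R).
Implicit Types f g h : Omega -> R.

Definition L1dist f g : \bar R := (\int[P]_w `|f w - g w|%:E)%E.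

Lemma L1dist_triangle f g h : measurable_fun setT f -> measurable_fun setT g ->
  measurable_fun setT h -> (L1dist f h <= L1dist f g + L1dist g h)%E.
Proof.
move=> mf mg mh.
have mE g1 g2 : measurable_fun setT g1 -> measurable_fun setT g2 ->
    measurable_fun setT (fun w : Omega => `|g1 w - g2 w|%:E).
  move=> m1 m2; apply/measurable_EFinP/measurableT_comp => //.
  exact: measurable_funB.
rewrite /L1dist -ge0_integralD//; [|exact: mE|exact: mE].
apply: ge0_le_integral => //; first exact: mE.
  by apply: emeasurable_funD; exact: mE.
by move=> w _; rewrite -EFinD lee_fin ler_distD.
Qed.

Variable G : nat -> set (set Omega).
Hypothesis GO : forall n, G n `<=` measurable.
Hypothesis Gmono : forall n, <<s G n>> `<=` <<s G n.+1>>.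

Definition approximable f := forall e : R, 0 < e -> exists n g,
  [/\ measurable_fun [set: g_sigma_algebraType (G n)] g,
      P.-integrable setT (EFin \o g) & (L1dist f g <= e%:E)%E].

Lemma approximable_measurable n f :
  measurable_fun [set: g_sigma_algebraType (G n)] f ->
  P.-integrable setT (EFin \o f) -> approximable f.
Proof.
move=> mf fi e e0; exists n, f; split => //; rewrite /L1dist.
by under eq_integral do rewrite subrr normr0; rewrite integral0 lee_fin ltW.
Qed.

Lemma approximableD f g : measurable_fun setT f -> measurable_fun setT g ->
  approximable f -> approximable g -> approximable (fun w => f w + g w).
Proof.
move=> mf mg af ag e e0; have e2 : 0 < e / 2 by rewrite divr_gt0.
have [n [f' [mf' f'i ff']]] := af _ e2; have [m [g' [mg' g'i gg']]] := ag _ e2.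
exists (maxn n m), (fun w => f' w + g' w); split.
- apply: measurable_funD.
    by apply: measurable_coarser mf'; apply: filtration_le => //; exact: leq_maxl.
  by apply: measurable_coarser mg'; apply: filtration_le => //; exact: leq_maxr.
- by have := integrableD measurableT f'i g'i; apply: eq_integrable => // w _.
rewrite (splitr e) EFinD; apply: le_trans (leeD ff' gg').
have mf'O := integrable_measurable f'i; have mg'O := integrable_measurable g'i.
rewrite /L1dist -ge0_integralD//; last 2 first.
- by apply/measurable_EFinP/measurableT_comp => //; exact: measurable_funB.
- by apply/measurable_EFinP/measurableT_comp => //; exact: measurable_funB.
apply: ge0_le_integral => //.
- apply/measurable_EFinP/measurableT_comp => //.
  by apply: measurable_funB; exact: measurable_funD.
- by apply: emeasurable_funD; apply/measurable_EFinP/measurableT_comp => //;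
    exact: measurable_funB.
move=> w _; rewrite -EFinD lee_fin.
have -> : f w + g w - (f' w + g' w) = f w - f' w + (g w - g' w) by ring.
exact: ler_normD.
Qed.

Lemma approximableZ f (k : R) : measurable_fun setT f ->
  approximable f -> approximable (fun w => k * f w).
Proof.
move=> mf af e e0; have k1 : 0 < `|k| + 1 by rewrite ltr_wpDl.
have [n [g [mg gi fg]]] := af _ (divr_gt0 e0 k1).
exists n, (fun w => k * g w); split; first exact: measurable_funM.
  by have := integrableZl measurableT k gi.
have mgO := integrable_measurable gi.
have mfg : measurable_fun setT (fun w => `|f w - g w|%:E).
  by apply/measurable_EFinP/measurableT_comp => //; exact: measurable_funB.
have -> : L1dist (fun w => k * f w) (fun w => k * g w) = (`|k|%:E * L1dist f g)%E.
  rewrite /L1dist -ge0_integralZl//.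
  by apply: eq_integral => w _; rewrite -EFinM -normrM mulrBr.
apply: (@le_trans _ _ (`|k|%:E * (e / (`|k| + 1))%:E)%E); first exact: lee_wpmul2l.
by rewrite -EFinM lee_fin mulrCA ger_pMr// ler_pdivrMr// mul1r lerDl.
Qed.

Lemma approximable_lim f : measurable_fun setT f ->
  (forall e : R, 0 < e -> exists g, [/\ measurable_fun setT g, approximable g &
    (L1dist f g <= e%:E)%E]) -> approximable f.
Proof.
move=> mf fP e e0; have e2 : 0 < e / 2 by rewrite divr_gt0.
have [g [mg ag fg]] := fP _ e2; have [n [h [mh hi gh]]] := ag _ e2.
exists n, h; split=> //; rewrite (splitr e) EFinD.
apply: le_trans (leeD fg gh); apply: L1dist_triangle => //.
exact: integrable_measurable hi.
Qed.

(** The events with an approximable indicator form a Dynkin class, which contains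
    the pi-system [\bigcup_n <<s G n>>]. *)
Lemma approximable_indic (S : set Omega) : <<s \bigcup_n G n>> S ->
  approximable \1_S.
Proof.
pose C := \bigcup_n <<s G n>>.
have CI : setI_closed C.
  move=> A B [m _ sA] [n _ sB]; exists (maxn m n) => //.
  have /(_ _ sA) sA' := filtration_le Gmono (leq_maxl m n).
  have /(_ _ sB) sB' := filtration_le Gmono (leq_maxr m n).
  exact: (@measurableI _ (g_sigma_algebraType (G (maxn m n)))).
suff : <<d C>> `<=` [set S | measurable S /\ approximable \1_S].
  rewrite setI_closed_g_dynkin_g_sigma_algebra// => CS sS.
  apply: (CS _ _).2; move: S sS; apply: sub_sigma_algebra2 => A [n _ GA].
  by exists n => //; exact: sub_sigma_algebra.
have indic_int (A : set Omega) : measurable A -> P.-integrable setT (EFin \o \1_A).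
  exact: integrable_indic.
apply: smallest_sub => /=; last first.
  move=> A [n _ sA]; have mA := sub_ambient (@GO n) sA; split=> //.
  apply: (approximable_measurable (n := n)); last exact: indic_int.
  exact: measurable_indic.
have a1 : approximable (cst 1).
  apply: (approximable_measurable (n := 0)) => //.
  exact: finite_measure_integrable_cst.
split=> [|A [mA aA]|F tF FP] /=.
- by rewrite indicT.
- split; first exact: measurableC.
  rewrite (_ : \1_(~` A) = fun w => cst 1 w + -1 * \1_A w); last first.
    apply/funext => w; rewrite !indicE in_setC mulN1r /=.
    by case: (w \in A); rewrite /= ?subrr ?subr0.
  by apply: approximableD => //; [exact: measurable_funM|exact: approximableZ].
have mF n : measurable (F n) by case: (FP n).
have mU : measurable (\bigcup_n F n) by exact: bigcupT_measurable.
split => //; apply: approximable_lim => // e e0.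
pose U N := \big[setU/set0]_(i < N) F i.
have mUN N : measurable (U N) by apply: bigsetU_measurable.
have aU N : approximable \1_(U N).
  elim: N => [|N IHN].
    rewrite /U big_ord0 indic0; apply: (approximable_measurable (n := 0)) => //.
    exact: finite_measure_integrable_cst.
  rewrite (_ : \1_(U N.+1) = fun w => \1_(U N) w + \1_(F N) w); last first.
    apply/funext => w; rewrite !indicE /U big_ord_recr/= in_setU.
    have tF' : trivIset (fun k => @predT nat k) F by exact: sub_trivIset tF.
    have : \big[setU/set0]_(i < N) F i `&` F N = set0.
      exact: (trivIset_bigsetUI tF' (n := N)).
    move/seteqP => [/(_ w)/= UF _]; move: UF.
    case: (boolP (w \in _)) => [/set_mem wU|_ _]; last by rewrite add0r.
    case: (boolP (w \in F N)) => [/set_mem wF|_ _]; last by rewrite addr0.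
    by case; split.
  by apply: approximableD => //; case: (FP N).
pose D N := \bigcup_n F n `\` U N.
have mD N : measurable (D N) by exact: measurableD.
have D0 : (P \o D) N @[N --> \oo] --> (0 : \bar R).
  have <- : P (\bigcap_n D n) = 0%E.
    rewrite (_ : \bigcap_n D n = set0) ?measure0//.
    apply/seteqP; split => // w Dw; have [[n _ Fn] _] := Dw 0%N I.
    have [_] := Dw n.+1 I; apply.
    by rewrite /U -(bigcup_mkord n.+1 F); exists n => /=.
  apply: nonincreasing_cvg_mu => //.
  - by rewrite ltey_eq fin_num_measure.
  - exact: bigcapT_measurable.
  - move=> m n mn; apply/subsetPset; apply: setDS; exact: subset_bigsetU.
move/fine_cvgP : D0 => [_ /cvgrPdist_le /(_ e e0) [N _ /(_ N (leqnn N))/= DN]].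
exists \1_(U N); split => //.
rewrite /L1dist.
under eq_integral => w _.
  have -> : `|\1_(\bigcup_n F n) w - \1_(U N) w| = \1_(D N) w :> R.
    rewrite !indicE in_setD; case: (boolP (w \in U N)) => [/set_mem wU|wU].
      have -> : w \in \bigcup_n F n by rewrite inE; exact: (bigsetU_bigcup wU).
      by rewrite subrr normr0.
    by rewrite subr0 andbT normr_nat.
  over.
rewrite integral_indic// setIT -[leLHS]fineK ?fin_num_measure// lee_fin.
by move: DN; rewrite sub0r normrN ger0_norm// fine_ge0.
Qed.

(** Simple functions are combinations of indicators, and they are dense in L1 for
    the restriction [mu] of [P] to the sigma-algebra of the whole filtration. *)
Lemma approximable_integrable f :
  measurable_fun [set: g_sigma_algebraType (\bigcup_n G n)] f ->
  P.-integrable setT (EFin \o f) -> approximable f.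
Proof.
pose H := \bigcup_n G n => mf fi.
have HO : H `<=` measurable by move=> A [n _]; exact: GO.
have mid := measurable_forget HO.
have mfO := measurable_ambient HO mf.
pose mu := distribution P (HB.pack_for {mfun Omega >-> g_sigma_algebraType H}
  (id : Omega -> g_sigma_algebraType H) (isMeasurableFun.Build _ _ _ _ _ mid)).
have fmui : mu.-integrable setT (EFin \o f).
  apply/integrable_pushforward => //.
  exact/measurable_EFinP.
have [g_ [gi _ g1]] := approximation_sfun_integrable measurableT fmui.
apply: approximable_lim => // e e0.
move/fine_cvgP : g1 => [[n0 _ gfin] /cvgrPdist_le /(_ e e0) [n1 _ gn]].
pose n := maxn n0 n1; have /= {}gfin := gfin n (leq_maxl _ _).
have /= {}gn := gn n (leq_maxr _ _).
have mg : measurable_fun [set: g_sigma_algebraType H] (g_ n) by exact: measurable_funP.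
have mgO : measurable_fun [set: Omega] (fun w : Omega => g_ n w).
  by apply: (measurable_ambient HO); exact: mg.
exists (fun w => g_ n w); split => //; last first.
  rewrite /L1dist.
  have E : (\int[mu]_w `|(EFin \o f) w - (g_ n w)%:E| =
      \int[P]_w `|f w - g_ n w|%:E)%E.
    rewrite ge0_integral_pushforward//.
    by apply/measurable_EFinP/measurableT_comp => //; exact: measurable_funB.
  rewrite -E -[leLHS]fineK// lee_fin.
  by move: gn; rewrite sub0r normrN => /(le_trans (ler_norm _)).
have -> : (fun w => g_ n w) =
    (fun w => \sum_(y <- finmap.enum_fset (fset_set (range (g_ n)))) y * \1_(g_ n @^-1` [set y] : set Omega) w).
  by apply/funext => w; rewrite fimfunE fsbig_finite.
have spre y : <<s H>> (g_ n @^-1` [set y]).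
  by have := mg measurableT _ (measurable_set1 y); rewrite setTI.
have mpre y : measurable (g_ n @^-1` [set y] : set Omega).
  by apply: (sub_ambient HO); exact: spre.
elim: (finmap.enum_fset _) => [|y s IHs].
  under eq_fun do rewrite big_nil.
  apply: (approximable_measurable (n := 0)) => //.
  exact: finite_measure_integrable_cst.
under eq_fun do rewrite big_cons.
apply: approximableD => //.
- exact: measurable_funM.
- by apply: measurable_sum => z; exact: measurable_funM.
- by apply: approximableZ => //; exact: approximable_indic.
Qed.

(** If [g] is measurable for [G n] and close to [f], then so is [M n], because
    [M n - g] is the conditional expectation of [f - g]. *)
Lemma martingale_L1_cvg f (M : nat -> Omega -> R) :
  measurable_fun [set: g_sigma_algebraType (\bigcup_n G n)] f ->
  P.-integrable setT (EFin \o f) -> (forall n, is_cond_exp P (G n) f (M n)) ->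
  forall e : R, 0 < e -> exists n, (\int[P]_w `|f w - M n w|%:E <= e%:E)%E.
Proof.
move=> mf fi GM e e0; have e2 : 0 < e / 2 by rewrite divr_gt0.
have [n [g [mg gi fg]]] := approximable_integrable mf fi e2; exists n.
have [mM Mi MI] := GM n.
have mgO := integrable_measurable gi; have mfO := integrable_measurable fi.
have mMO := integrable_measurable Mi.
have fgi := integrable_sub fi gi.
have gg : is_cond_exp P (G n) g g by split.
rewrite (splitr e) EFinD; apply: (@le_trans _ _ (L1dist f g + L1dist g (M n))%E).
  exact: L1dist_triangle.
apply: leeD => //; apply: le_trans fg.
have := cond_exp_L1 (@GO n) fgi (is_cond_expB fi gi (@GO n) (GM n) gg).
by apply: le_trans; rewrite /L1dist; under eq_integral do rewrite distrC.
Qed.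

End approximation.

(** * Conditional independence *)

Section independence.
Context {d : measure_display} {Omega : measurableType d} {R : realType}
  (P : probability Omega R).

(** If the conditional probabilities given [H] of the events of [L] are already
    measurable for the coarser [K], then adding [L] to [K] does not help to
    predict an [H]-measurable [h]. *)
Lemma is_cond_exp_joinr (K H L : set (set Omega)) (h V : Omega -> R) :
  K `<=` measurable -> H `<=` measurable -> L `<=` measurable ->
  <<s K>> `<=` <<s H>> -> setI_closed L -> L setT ->
  (forall S, L S -> exists2 q : Omega -> R,
    measurable_fun [set: g_sigma_algebraType K] q & is_cond_exp P H \1_S q) ->
  P.-integrable setT (EFin \o h) ->
  measurable_fun [set: g_sigma_algebraType H] h ->
  is_cond_exp P K h V -> is_cond_exp P (K `|` L) h V.
Proof.
move=> KO HO LO KH LI LT Lq hi mh KV; have [mV Vi VI] := KV.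
pose KL := K `|` L; have KLO : KL `<=` measurable by move=> A [/KO|/LO].
split => //.
  by apply: measurable_coarser mV; apply: sub_sigma_algebra2; exact: subsetUl.
move=> B sB; have mB := sub_ambient KLO sB.
have hVi := integrable_sub hi Vi.
suff hV0 : (\int[P]_(w in B) ((h \- V) w)%:E = 0)%E.
  have hfin := integrable_fin_num mB (integrable_on mB hi).
  have Vfin := integrable_fin_num mB (integrable_on mB Vi).
  move: hV0; rewrite integral_sub// => /eqP.
  by rewrite sube_eq ?fin_num_adde_defl// add0e => /eqP.
pose C := [set D | exists T S, [/\ <<s K>> T, L S & D = T `&` S]].
have CO : C `<=` measurable.
  move=> _ [T [S [sT LS ->]]]; apply: measurableI; last exact: LO.
  exact: (sub_ambient KO).
have sKI (T1 T2 : set Omega) : <<s K>> T1 -> <<s K>> T2 -> <<s K>> (T1 `&` T2).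
  exact: (@measurableI _ (g_sigma_algebraType K)).
have sKT : <<s K>> setT by exact: (@measurableT _ (g_sigma_algebraType K)).
have onC : forall D, C D -> (\int[P]_(w in D) ((h \- V) w)%:E = 0)%E.
  move=> _ [T [S [sT LS ->]]].
  have [q mq Hq] := Lq S LS; have [mqH qi qI] := Hq.
  have mT := sub_ambient KO sT; have mS := LO _ LS.
  have mqO := integrable_measurable qi.
  have mhVO := integrable_measurable hVi.
  have Si : P.-integrable setT (EFin \o \1_S) by exact: integrable_indic.
  have q1 : {ae P, forall w, `|q w| <= 1}.
    apply: (cond_exp_norm_le HO Si Hq) => w; rewrite indicE.
    by case: (w \in S); rewrite ?normr1 ?normr0.
  have Sqi := integrable_sub Si qi.
  have T1 w : `|\1_T w : R| <= 1.
    by rewrite indicE; case: (w \in T); rewrite ?normr1 ?normr0.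
  have T_i : P.-integrable setT (fun w => ((\1_T w * q w) * (h \- V) w)%:E).
    apply: (ae_le_integrable _ hVi).
      by apply: measurable_funM => //; exact: measurable_funM.
    apply: filterS q1 => w qw; rewrite normrM ler_piMl// normrM.
    by rewrite -[leRHS]mulr1 ler_pM.
  have T_i' : P.-integrable setT
      (fun w => (((h \- V) w * \1_T w) * (\1_S \- q) w)%:E).
    apply: (@ae_le_integrable _ _ _ _ _ (fun w => 2 * (h \- V) w)).
    - apply: measurable_funM; last exact: measurable_funB.
      exact: measurable_funM.
    - exact: (integrableZl measurableT 2 hVi).
    - apply: filterS q1 => w qw; rewrite !normrM -mulrA [leRHS]mulrC ler_wpM2l//.
      rewrite [leRHS]ger0_norm// -[leRHS]mul1r ler_pM//.
      rewrite (le_trans (ler_normB _ _))// -[leRHS](_ : 1 + 1 = 2)// lerD//.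
      by rewrite indicE; case: (w \in S); rewrite ?normr1 ?normr0.
  (* (h - V) 1_T 1_S = (h - V) 1_T (1_S - q) + 1_T q (h - V): the first term
     integrates to 0 because [1_S - q] is orthogonal to [H], the second because
     [h - V] is orthogonal to [K]. *)
  rewrite integral_indicM indicI.
  transitivity (\int[P]_w ((((h \- V) w * \1_T w) * (\1_S \- q) w)%:E +
    ((\1_T w * q w) * (h \- V) w)%:E))%E.
    by apply: eq_integral => w _; rewrite -EFinD /=; congr EFin; ring.
  rewrite integralD//.
  rewrite (integral_mul_eq0 HO Sqi (residual_eq0 HO Si Hq)) ?add0e//; last first.
    apply: measurable_funM; last by apply: measurable_indic; exact: KH.
    by apply: measurable_funB => //; exact: measurable_coarser mV.
  apply: (integral_mul_eq0 KO hVi (residual_eq0 KO hi KV)) => //.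
  by apply: measurable_funM => //; exact: measurable_indic.
apply: (integral_eq0_dynkin CO) => //.
- move=> _ _ [T [S [sT LS ->]]] [T' [S' [sT' LS' ->]]].
  exists (T `&` T'), (S `&` S'); split; [exact: sKI|exact: LI|].
  by rewrite setIACA.
- by apply: onC; exists setT, setT; rewrite setIT.
- have KLC : KL `<=` C.
    move=> A [KA|LA]; last by exists setT, A; rewrite setTI.
    exists A, setT; rewrite setIT; split=> //; exact: sub_sigma_algebra.
  exact: (sub_sigma_algebra2 KLC).
Qed.

End independence.

(** * Revealing the coordinates one by one *)

Section exploration.
Context {d : measure_display} {Omega : measurableType d} {R : realType}
  (P : probability Omega R) (A : countType) (E0 : ptopologicalType)
  (E : A -> ptopologicalType) (Z : Omega -> E0) (X : forall a, Omega -> E a).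
Hypothesis ZO : sigma_of Z `<=` measurable.
Hypothesis XO : forall a, sigma_of (X a) `<=` measurable.

Lemma sigma_of_setI (T : ptopologicalType) (Y : Omega -> T) :
  setI_closed (sigma_of Y).
Proof.
move=> _ _ [B mB <-] [C mC <-]; exists (B `&` C); first exact: measurableI.
by rewrite !setTI preimage_setI.
Qed.

Lemma sigma_of_setT (T : ptopologicalType) (Y : Omega -> T) : sigma_of Y setT.
Proof. by exists setT => //; rewrite setTI preimage_setT. Qed.

Lemma measurable_prodType (G : set (set Omega)) (phi : Omega -> forall a, E a) :
  (forall a (B : set (borelType (E a))), measurable B ->
    <<s G>> ((fun w => phi w a) @^-1` B)) ->
  measurable_fun [set: g_sigma_algebraType G] (phi : _ -> prodType E).
Proof.
move=> phiP; apply: (@measurability _ _ (g_sigma_algebraType G) (prodType E)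
  setT phi (cylinders E) erefl).
by move=> _ [_ [a _ [B mB <-]] <-]; rewrite !setTI; exact: phiP.
Qed.

(** Generators, not yet a sigma-algebra, so that [explored 0] is [sigma_of Z]
    itself and one step adjoins at most one [sigma_of (X a)]. *)
Definition explored (n : nat) : set (set Omega) :=
  sigma_of Z `|` \bigcup_(a in [set a | (pickle a < n)%N]) sigma_of (X a).

Lemma explored0 : explored 0 = sigma_of Z.
Proof.
rewrite /explored (_ : [set a | _] = set0) ?bigcup_set0 ?setU0//.
by apply/seteqP; split.
Qed.

Lemma explored_ambient n : explored n `<=` measurable.
Proof. by move=> S [/ZO//|[a _ /XO]]. Qed.

Lemma explored_mono n : <<s explored n>> `<=` <<s explored n.+1>>.
Proof.
apply: sub_sigma_algebra2 => S [?|[a an Xa]]; first by left.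
by right; exists a => //=; exact: ltnW.
Qed.

Lemma exploredS n : explored n.+1 =
  if pickle_inv n is Some a then explored n `|` sigma_of (X a) else explored n.
Proof.
have split_lt (b : A) : (pickle b < n.+1)%N ->
    (pickle b < n)%N \/ pickle_inv n = Some b.
  rewrite ltnS leq_eqVlt => /predU1P[<-|]; last by left.
  by right; exact: pickleK_inv.
apply/seteqP; split=> [S [ZS|[b /= /split_lt bn bS]]|S].
- by case: pickle_inv => [a|]; left => //; left.
- case: bn => [bn|-> ]; last by right.
  by case: pickle_inv => [a|]; [left|]; right; exists b.
- have keep : explored n S -> explored n.+1 S.
    by move=> [?|[b bn ?]]; [left|right; exists b => //=; exact: ltnW].
  case e : (pickle_inv n) => [a|//] [//|aS]; right; exists a => //=.
  by have := @pickle_invK A n; rewrite e /= => ->.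
Qed.

Lemma measurable_joint :
  measurable_fun [set: g_sigma_algebraType (\bigcup_n explored n)]
    (joint X : _ -> prodType E).
Proof.
apply: measurable_prodType => a B mB; apply: sub_sigma_algebra.
exists (pickle a).+1 => //; right; exists a => //=.
by exists B => //; rewrite setTI.
Qed.

Lemma measurable_dfwith_joint a (y : E a) :
  measurable_fun [set: g_sigma_algebraType (sigma_others Z X a)]
    ((fun w => dfwith (joint X w) a y) : _ -> prodType E).
Proof.
apply: measurable_prodType => b B mB.
have [e|ba] := eqVneq a b.
  subst b; rewrite (_ : _ @^-1` B = if y \in B then setT else set0); last first.
    apply/seteqP; split => w /=; rewrite dfwithin.
      by move=> /mem_set ->.
    by case: ifPn => // /set_mem.
  case: ifP => _; [exact: (@measurableT _ (g_sigma_algebraType _))|].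
  exact: (@measurable0 _ (g_sigma_algebraType _)).
apply: sub_sigma_algebra; apply: sub_sigma_algebra; right; exists b.
  by apply/eqP; rewrite eq_sym.
exists B => //; rewrite setTI; apply/seteqP.
by split => w /=; rewrite dfwithout.
Qed.

Lemma sigma_others_ambient a : sigma_others Z X a `<=` measurable.
Proof. by apply: sub_ambient => S [/ZO//|[b _ /XO]]. Qed.

(** With the coordinate [a] frozen, [F] is a function of the other coordinates:
    by conditional independence, revealing [X a] does not change its
    conditional expectation. *)
Lemma cond_exp_frozen (F : (forall a, E a) -> R) n a (y : E a) V :
  cond_independent P Z X -> measurable_fun [set: prodType E] F ->
  P.-integrable setT (EFin \o (fun w => F (dfwith (joint X w) a y))) ->
  pickle_inv n = Some a ->
  is_cond_exp P (explored n) (fun w => F (dfwith (joint X w) a y)) V ->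
  is_cond_exp P (explored n.+1) (fun w => F (dfwith (joint X w) a y)) V.
Proof.
move=> indX mF hi na hV; rewrite exploredS na.
have an : pickle a = n by have := @pickle_invK A n; rewrite na.
have subH : explored n `<=` sigma_others Z X a.
  move=> S [ZS|[b bn bS]]; apply: sub_sigma_algebra; first by left.
  by right; exists b => // ba; move: bn; rewrite /= ba an ltnn.
have ZH : sigma_of Z `<=` sigma_others Z X a.
  by move=> S ZS; apply: sub_sigma_algebra; left.
have HO := @sigma_others_ambient a.
apply: (is_cond_exp_joinr (H := sigma_others Z X a)) => //.
- exact: explored_ambient.
- exact: sub_sigma_algebra2.
- exact: sigma_of_setI.
- exact: sigma_of_setT.
- move=> _ [B mB <-]; rewrite setTI.
  have mXB : measurable (X a @^-1` B) by apply: (@XO a); exists B => //; rewrite setTI.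
  have Xi : P.-integrable setT (EFin \o \1_(X a @^-1` B)) by exact: integrable_indic.
  have [mq qi qI] := cond_expP ZO Xi.
  have [mp p_i pI] := cond_expP HO Xi.
  exists (cond_exp P (sigma_of Z) \1_(X a @^-1` B)).
    by apply: measurable_coarser mq; apply: sub_sigma_algebra2 => S ZS; left.
  split=> //; first by apply: measurable_coarser mq; exact: sub_sigma_algebra2.
  move=> D sD; rewrite -pI//; have mD := sub_ambient HO sD.
  apply: ae_eq_integral => //.
  + exact: measurable_int (integrable_on mD qi).
  + exact: measurable_int (integrable_on mD p_i).
  + have := indX a B mB; apply: filterS => w e _.
    by rewrite /= -[X in EFin X]e.
- exact: (measurableT_comp mF (@measurable_dfwith_joint a y)).
Qed.

End exploration.

(** * The conditional tail bound *)

Lemma cond_prob_le (disp : measure_display) (Omega : measurableType disp)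
    (R : realType) (P : probability Omega R) (G : set (set Omega))
    (S : set Omega) (k : R) :
  G `<=` measurable -> measurable S ->
  (forall B, <<s G>> B -> (P (B `&` S) <= k%:E * P B)%E) ->
  {ae P, forall w, cond_prob P G S w <= k}.
Proof.
move=> GO mS PS.
have Si : P.-integrable setT (EFin \o \1_S) by exact: integrable_indic.
have [mq qi qI] := cond_expP GO Si.
rewrite -/(cond_prob P G S) in mq qi qI *.
have ki : P.-integrable setT (EFin \o cst k) by exact: finite_measure_integrable_cst.
have : {ae P, forall w, 0 <= k - cond_prob P G S w}.
  apply: (@ae_ge0 _ _ _ _ G (cst k \- cond_prob P G S)) => //.
  - exact: measurable_funB.
  - exact: integrable_sub.
  - move=> B sB; have mB := sub_ambient GO sB.
    rewrite integral_sub// qI// integral_indic// setIC.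
    have -> : (\int[P]_(w in B) (cst k w)%:E = k%:E * P B)%E.
      exact: (integral_cst P mB k%:E).
    by rewrite sube_ge0 ?PS// fin_num_measure//; exact: measurableI.
by apply: filterS => w; rewrite subr_ge0.
Qed.

Lemma sum_pickle_le_esum (R : realType) (A : countType) (u : A -> R) n :
  (forall a, 0 <= u a) ->
  ((\sum_(k < n) (if pickle_inv k is Some a then u a else 0))%:E
    <= \esum_(a in [set: A]) (u a)%:E)%E.
Proof.
move=> u0; pose r := pmap (@pickle_inv A) (iota 0 n).
have ur : uniq r.
  by apply: (pmap_uniq (g := pickle)); [exact: pickle_invK|exact: iota_uniq].
apply: esum_ge; exists [set` r]; first by split => //; exact: finite_seq.
rewrite -fsbig_seq// sumEFin lee_fin /r -(big_mkord xpredT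
  (fun k => if pickle_inv k is Some a then u a else 0)) /index_iota subn0.
rewrite le_eqVlt; apply/orP; left; apply/eqP.
elim: (iota 0 n) => [|k s IHs]; first by rewrite !big_nil.
by rewrite big_cons IHs /=; case: pickle_inv => [a|]/=; rewrite ?big_cons ?add0r.
Qed.

(** The best exponent is [s = x / V]. For [V = 0] the right-hand side is 0, as
    [x ^+ 2 / 0 = +oo] in the extended reals, and it is reached by letting [s]
    tend to infinity. *)
Lemma chernoff_optimal (R : realType) (x V p q : R) : 0 < x -> 0 <= V ->
  0 <= q ->
  (forall s, 0 <= s -> p <= expR (- (s * x) + s ^+ 2 * V / 2) * q) ->
  (p%:E <= expeR (- ((x ^+ 2)%:E / (2%:E * V%:E))) * q%:E)%E.
Proof.
move=> x0 V0 q0 pq; rewrite -EFinM inver.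
have [V0'|Vn0] := eqVneq V 0.
  subst V; rewrite mulr0 eqxx mulry gtr0_sg ?exprn_gt0// mul1e /= mul0e lee_fin.
  apply/ler_addgt0Pr => e e0; rewrite add0r.
  have qe1 : 0 <= q / e by rewrite divr_ge0 // ltW.
  have := pq _ (divr_ge0 qe1 (ltW x0)); rewrite mulr0 mul0r addr0 mulfVK ?gt_eqF//.
  move/le_trans; apply; rewrite expRN mulrC ler_pdivrMr ?expR_gt0//.
  have := expR_ge1Dx (q / e); rewrite -(ler_pM2l e0); apply: le_trans.
  by rewrite mulrDr mulrCA divff ?gt_eqF// !mulr1 lerDr ltW.
have Vp : 0 < V by rewrite lt_neqAle eq_sym Vn0.
rewrite mulf_eq0 (negbTE Vn0) orbF pnatr_eq0/= -EFinM lee_fin.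
apply: (le_trans (pq _ (divr_ge0 (ltW x0) V0))).
by rewrite le_eqVlt; apply/orP; left; apply/eqP; congr (expR _ * _); field.
Qed.

Theorem theorem3p5 (R : realType) (disp : measure_display)
    (Omega : measurableType disp) (P : probability Omega R)
    (A : countType) (E0 : ptopologicalType) (E : A -> ptopologicalType)
    (polE0 : polish R E0) (polE : forall a, polish R (E a))
    (Z : {RV P >-> borelType E0}) (X : forall a, {RV P >-> borelType (E a)})
    (indX : cond_independent P Z (fun a => X a))
    (F : (forall a, E a) -> R) (mF : measurable_fun [set: prodType E] F)
    (FX2 : F \o joint X \in Lfun P 2%:E)
    (d : A -> R)
    (dF : forall a : A,
      (ereal_sup [set `| F (dfwith y a y') - F y |%:E
                 | y in [set: forall b, E b] & y' in [set: E a]] <= (d a)%:E)%E)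
    (x : R) (x_gt0 : 0 < x) :
  {ae P, forall w,
    ((cond_prob P (sigma_of Z)
        [set v | x <= F (joint X v)
                      - cond_exp P (sigma_of Z) (F \o joint X) v] w)%:E
     <= expeR (- ((x ^+ 2)%:E
                  / (2%:E * \esum_(a in [set: A]) ((d a) ^+ 2)%:E))))%E}.
Proof.
pose f := F \o joint X; rewrite -/f in FX2 *.
have fi : P.-integrable setT (EFin \o f).
  by apply/Lfun1_integrable; apply: Lfun_subset12 FX2; exact: fin_num_measure.
have osc a y y' : `|F (dfwith y a y') - F y| <= d a.
  rewrite -lee_fin; apply: le_trans (dF a); apply: ereal_sup_ubound.
  by exists y => //; exists y'.
have d0 a : 0 <= d a by exact: le_trans (normr_ge0 _) (osc a point point).
have ZO : sigma_of Z `<=` measurable.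
  by move=> _ [B mB <-]; exact: (measurable_funP Z).
have XO a : sigma_of (X a) `<=` measurable.
  by move=> _ [B mB <-]; exact: (measurable_funP (X a)).
pose G := explored Z (fun a => X a).
have GO n : G n `<=` measurable by exact: explored_ambient.
have Gmono n : <<s G n>> `<=` <<s G n.+1>> by exact: explored_mono.
pose M n := cond_exp P (G n) f.
have GM n : is_cond_exp P (G n) f (M n) by exact: cond_expP.
have G0 : G 0 = sigma_of Z by exact: explored0.
pose c n := if pickle_inv n is Some a then d a else 0.
have c0 n : 0 <= c n by rewrite /c; case: pickle_inv.
have increment n : exists h V,
    [/\ P.-integrable setT (EFin \o h), forall w, `|f w - h w| <= c n,
        is_cond_exp P (G n) h V & is_cond_exp P (G n.+1) h V].
  rewrite /c; case na : (pickle_inv n) => [a|]; last first.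
    exists f, (M n); split => //; first by move=> w; rewrite subrr normr0.
    by rewrite /G exploredS na; exact: GM.
  (* Freeze the coordinate [a] at an arbitrary value. *)
  pose h w := F (dfwith (joint X w) a (point : E a)).
  have fh w : `|f w - h w| <= d a by rewrite distrC; exact: osc.
  have mh : measurable_fun setT h.
    have := measurableT_comp mF
      (@measurable_dfwith_joint _ _ A E0 E Z (fun a => X a) a point).
    by apply: measurable_ambient; exact: sigma_others_ambient.
  have hi : P.-integrable setT (EFin \o h).
    have := integrableD measurableT (integrable_norm fi)
      (finite_measure_integrable_cst P (d a) measurableT).
    apply: le_integrable => //; first exact/measurable_EFinP.
    move=> w _ /=; rewrite lee_fin [leRHS]ger0_norm ?addr_ge0//.
    have := ler_normB (f w) (f w - h w); rewrite subKr => /le_trans; apply.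
    by rewrite lerD2l.
  have hV := cond_expP (GO n) hi.
  exists h, (cond_exp P (G n) h); split => //.
  exact: cond_exp_frozen.
pose S := [set v | x <= f v - M 0 v].
have mf := integrable_measurable fi.
have mS : measurable S.
  rewrite -[S]setTI; apply: measurable_fun_le => //.
  exact: measurable_funB mf (measurable_martingale GO GM 0).
have M0E : cond_exp P (sigma_of Z) f = M 0 by rewrite /M G0.
rewrite M0E -/S.
set K := expeR _.
have K0 : (0 <= K)%E by exact: expeR_ge0.
have tail B : <<s G 0>> B -> (P (B `&` S) <= K * P B)%E.
  move=> sB; have mB := sub_ambient (GO 0) sB.
  have cS n := sum_pickle_le_esum n (fun a => sqr_ge0 (d a)).
  have Sig0 : (0 <= \esum_(a in [set: A]) ((d a) ^+ 2)%:E)%E.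
    by apply: esum_ge0 => a _; rewrite lee_fin sqr_ge0.
  rewrite /K; case: (\esum_(a in _) _)%E cS Sig0 => [V| |//] cS V0; last first.
    (* For an infinite sum the bound is [expeR 0 = 1]. *)
    rewrite gt0_muley// invey mule0 oppe0 expeR0 mul1e.
    by apply: le_measure; rewrite ?inE//; first [exact: measurableI|exact: subIsetl].
  rewrite -[in leLHS](fineK (fin_num_measure P _ (measurableI _ _ mB mS))).
  rewrite -[in leRHS](fineK (fin_num_measure P _ mB)).
  apply: chernoff_optimal => //; [exact: fine_ge0|] => s s0.
  rewrite -lee_fin EFinM !fineK ?fin_num_measure//; last exact: measurableI.
  apply: (azuma_limit GO Gmono fi GM c0 increment x _ _ sB s0).
    move=> n; rewrite -lee_fin; apply: le_trans (cS n); rewrite lee_fin.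
    rewrite le_eqVlt; apply/orP; left; apply/eqP; apply: eq_bigr => k _.
    by rewrite /c; case: pickle_inv => //; rewrite expr0n.
  apply: (martingale_L1_cvg GO Gmono) => //.
  exact: (measurableT_comp mF (@measurable_joint _ _ A E0 E Z (fun a => X a))).
have Kfin : K \is a fin_num.
  rewrite ge0_fin_numE//; apply: (@le_lt_trans _ _ 1%E); last exact: ltry.
  rewrite -expeR0 lee_expeR oppe_le0 mule_ge0 ?lee_fin ?sqr_ge0// inve_ge0.
  by apply: mule_ge0 => //; apply: esum_ge0 => a _; rewrite lee_fin sqr_ge0.
rewrite -(fineK Kfin).
have : {ae P, forall w, cond_prob P (sigma_of Z) S w <= fine K}.
  by apply: cond_prob_le => // B; rewrite fineK// -G0; exact: tail.
by apply: filterS => w; rewrite lee_fin.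
Qed.
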